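(* For $0<p<1$ let $$\Omega_p=\left\{-\frac{(1-p^2)^2\zeta}{(1-p^2\zeta)^2}:\ \zeta\in\mathbb{C},\ |\zeta|\le 1\right\}.$$ Then $\Omega_p\subset\Omega_q$ whenever $0<q<p<1$, and $$\bigcup_{0<p<1}\Omega_p=\mathbb{D}\cup\{-1\}\quad\text{and}\quad\bigcap_{0<p<1}\Omega_p=\left\{-\frac{(1+z)^2}{4}:\ z\in\mathbb{C},\ |z|\le1\right\}.$$
   Context: $\mathbb{D}=\{z\in\mathbb{C}:|z|<1\}$ is the open unit disk. *)

(* Defs.v *)
From mathcomp Require Import all_boot all_order all_algebra.
From mathcomp Require Import all_classical reals.
From mathcomp Require Import complex.

Set Implicit Arguments.
Unset Strict Implicit.
Unset Printing Implicit Defensive.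

Import Order.TTheory GRing.Theory Num.Theory.

Local Open Scope ring_scope.
Local Open Scope complex_scope.
Local Open Scope classical_set_scope.

Section Defs.
Variable R : realType.

(* [`|z|] is itself an element of [R[i]]; as it is real, the partial order of
   [R[i]] compares it with 1 as in [R]. *)
Definition open_unit_disk : set R[i] := [set z | `|z| < 1].

Definition Omega (p : R) : set R[i] :=
  [set - ((1 - p%:C ^+ 2) ^+ 2 * zeta / (1 - p%:C ^+ 2 * zeta) ^+ 2)
     | zeta in [set zeta : R[i] | `|zeta| <= 1]].

End Defs.

Arguments open_unit_disk : clear implicits.

(* Main.v *)
Require Import Defs.
From mathcomp Require Import all_boot all_order all_algebra.
From mathcomp Require Import all_classical reals.
From mathcomp Require Import complex.
From mathcomp Require Import ring lra.

Set Implicit Arguments.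
Unset Strict Implicit.
Unset Printing Implicit Defensive.

Import Order.TTheory GRing.Theory Num.Theory.

Local Open Scope ring_scope.
Local Open Scope complex_scope.
Local Open Scope classical_set_scope.

(** Put [a = p^2] and [c = 2a / (1 - a)^2]. If [w] is the point of [Omega p]
with parameter [zeta] and [r = (1 + a zeta) / (1 - a zeta)], then
[1 - 2cw = r^2], and [|zeta| <= 1] becomes [|r - 1| <= a |r + 1|]. By the
parallelogram law this says that [w] belongs to [Omega p] iff
[(2 + 2c) |w| <= 1 + |1 - 2cw|]; equivalently, [1/w] lies outside an ellipse
with foci [0] and [2c]. Since [|1 - 2cw| - 2c|w|] decreases in [c], and [c]
increases with [p] from [0] to [+oo], the sets decrease; letting [c] tend to
[0] and to [+oo] gives the union and the intersection, the latter being
[2 |w|^2 <= |w| - Re w], which describes the squares [w = - s^2] with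
[|s|^2 <= Re s]. *)

Local Notation normc := ComplexField.Normc.normc.

(** * Real-valued modulus and complex square roots *)

Section ComplexNorm.
Variable R : rcfType.
Implicit Types (z w : R[i]) (k : R).

Lemma normE z : `|z| = (normc z)%:C.
Proof. by case: z. Qed.

Lemma normc_ge0 z : 0 <= normc z.
Proof. by rewrite -lecR -normE normr_ge0. Qed.

Lemma sqr_normcE z : normc z ^+ 2 = complex.Re z ^+ 2 + complex.Im z ^+ 2.
Proof. by case: z => x y /=; rewrite sqr_sqrtr ?addr_ge0 ?sqr_ge0. Qed.

Lemma normcX2 z : normc (z ^+ 2) = normc z ^+ 2.
Proof. by rewrite !expr2 ComplexField.Normc.normcM. Qed.

Lemma normc_real k : 0 <= k -> normc k%:C = k.
Proof. by move=> k0; rewrite /= expr0n addr0 sqrtr_sqr ger0_norm. Qed.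

Lemma ler_normcD z w : normc (z + w) <= normc z + normc w.
Proof. exact: le_normcD. Qed.

Lemma normc_opp z : normc (- z) = normc z.
Proof. exact: normcN. Qed.

Lemma normc_parallelogram z :
  normc (z + 1) ^+ 2 + normc (z - 1) ^+ 2 = 2 + 2 * normc z ^+ 2.
Proof. by rewrite !sqr_normcE; case: z => x y /=; ring. Qed.

Lemma sqr_normc_1subM k w :
  normc (1 - k%:C * w) ^+ 2 =
  1 - 2 * k * complex.Re w + k ^+ 2 * normc w ^+ 2.
Proof. by rewrite !sqr_normcE; case: w => x y /=; ring. Qed.

(** Choosing this root [s] makes [s] at least as close to 1 as to -1, and recovers [Re s] from its
    square. *)
Lemma complex_sqrt_Re_ge0 w : exists2 s : R[i], s ^+ 2 = w & 0 <= complex.Re s.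
Proof.
have [h|h] := leP 0 (complex.Re (sqrtc w)).
  by exists (sqrtc w) => //; rewrite sqr_sqrtc.
exists (- sqrtc w); first by rewrite sqrrN sqr_sqrtc.
by case: (sqrtc w) h => x y /=; lra.
Qed.

End ComplexNorm.

(** * The parameter [c] as a function of [p] *)

Section OmegaParam.
Variable R : rcfType.
Implicit Types p q : R.

Definition omega_param p : R := 2 * p ^+ 2 / (1 - p ^+ 2) ^+ 2.

Lemma sqr_lt1 p : 0 < p -> p < 1 -> 0 < p ^+ 2 < 1.
Proof. by move=> p0 p1; nra. Qed.

Lemma omega_paramE p : 0 < p -> p < 1 ->
  omega_param p * (1 - p ^+ 2) ^+ 2 = 2 * p ^+ 2.
Proof.
move=> p0 p1; have /andP[a0 a1] := sqr_lt1 p0 p1.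
by rewrite /omega_param; field; rewrite subr_eq0 gt_eqF.
Qed.

Lemma omega_param_gt0 p : 0 < p -> p < 1 -> 0 < omega_param p.
Proof.
move=> p0 p1; have /andP[a0 a1] := sqr_lt1 p0 p1.
by rewrite divr_gt0 ?mulr_gt0 ?exprn_gt0 ?subr_gt0.
Qed.

Lemma omega_param_le p q : 0 < q -> q < p -> p < 1 ->
  omega_param q <= omega_param p.
Proof.
move=> q0 qp p1; have /andP[a0 a1] := sqr_lt1 (lt_trans q0 qp) p1.
have qa : q ^+ 2 < p ^+ 2 by nra.
have b0 : 0 < 1 - p ^+ 2 by lra.
have le_ba : (1 - p ^+ 2) ^+ 2 <= (1 - q ^+ 2) ^+ 2 by nra.
apply: ler_pM; rewrite ?invr_ge0 ?sqr_ge0 //; try nra.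
by rewrite lef_pV2 // posrE exprn_gt0 //; lra.
Qed.

Lemma omega_param_small p : 0 < p -> p <= 2^-1 -> omega_param p <= 2 * p.
Proof.
move=> p0 p2; have p1 : p < 1 by lra.
have := omega_paramE p0 p1; have := omega_param_gt0 p0 p1.
have a1 : p ^+ 2 <= 4^-1 by nra.
(* Hence [c <= 4 * p ^+ 2], which is at most [2 * p] since [p <= 1/2]. *)
have b1 : 2^-1 <= (1 - p ^+ 2) ^+ 2 by nra.
move: (omega_param p) => c c0 ce; nra.
Qed.

Lemma omega_param_unbounded (M : R) :
  exists p, [/\ 0 < p, p < 1 & M <= omega_param p].
Proof.
pose K := `|M| + 1; have MK : M <= K by rewrite /K; have := ler_norm M; lra.
have K1 : 1 <= K by rewrite /K; have := normr_ge0 M; lra.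
(* For [p = 1 - e], [1 - p ^+ 2 <= 2 * e] and [2 * p ^+ 2 >= 1], so
   [c >= 1 / (4 * e ^+ 2) >= 1 / e = 8 * K]. *)
pose e := (8 * K)^-1.
have eK : e * (8 * K) = 1 by rewrite /e mulVf //; lra.
have e0 : 0 < e by rewrite invr_gt0; lra.
have e8 : e <= 8^-1 by nra.
have p0 : 0 < 1 - e by lra.
have p1 : 1 - e < 1 by lra.
exists (1 - e); split=> //.
have := omega_paramE p0 p1; have := omega_param_gt0 p0 p1.
move: (omega_param _) => c c0 ce.
have b4 : (1 - (1 - e) ^+ 2) ^+ 2 <= 4 * e ^+ 2 by nra.
have : 1 <= c * (4 * e ^+ 2) by nra.
have : 4 * e ^+ 2 <= e by nra.
move=> e4 c4; have : 1 <= c * e by nra.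
nra.
Qed.

End OmegaParam.

(** * Membership in [Omega p] as an inequality between moduli *)

Section OmegaCriterion.
Variables (R : realType) (p : R).
Hypotheses (p0 : 0 < p) (p1 : p < 1).
Implicit Types r w : R[i].

Let c := omega_param p.

Lemma param_complex :
  [/\ p%:C != 0, 1 - p%:C ^+ 2 != 0 &
      c%:C * (1 - p%:C ^+ 2) ^+ 2 = 2 * p%:C ^+ 2].
Proof.
have /andP[a0 a1] := sqr_lt1 p0 p1.
have cE : c%:C * (1 - p%:C ^+ 2) ^+ 2 = 2 * p%:C ^+ 2.
  have := congr1 (real_complex R) (omega_paramE p0 p1).
  by rewrite !(rmorphM, rmorphXn, rmorphB, rmorph1, rmorph_nat).
split=> //.
- by rewrite fmorph_eq0 gt_eqF.
- rewrite -rmorphXn -(rmorph1 (real_complex R)) -rmorphB fmorph_eq0.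
  by rewrite subr_eq0 gt_eqF.
Qed.

Lemma OmegaP w :
  Omega p w <->
  exists2 r : R[i], r ^+ 2 = 1 - (2 * c)%:C * w
           & normc (r - 1) <= p ^+ 2 * normc (r + 1).
Proof.
have /andP[a0 a1] := sqr_lt1 p0 p1.
have [pN0 bN0 cE] := param_complex.
have normM (z : R[i]) : normc (p%:C ^+ 2 * z) = p ^+ 2 * normc z.
  rewrite ComplexField.Normc.normcM -rmorphXn normc_real //; exact: ltW.
have c2 : (2 * c)%:C = 4 * p%:C ^+ 2 / (1 - p%:C ^+ 2) ^+ 2.
  rewrite rmorphM rmorph_nat; apply: (mulIf (expf_neq0 2 bN0)).
  by rewrite divfK ?expf_neq0 // -mulrA cE; ring.
split=> [[z /= z1 <-]|[r rE rle]].
  have {}z1 : normc z <= 1 by rewrite -lecR -normE.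
  have dN0 : 1 - p%:C ^+ 2 * z != 0.
    apply/eqP => /subr0_eq/(congr1 (@ComplexField.Normc.normc R)).
    by rewrite normM ComplexField.Normc.normc1; have := normc_ge0 z; nra.
  exists ((1 + p%:C ^+ 2 * z) / (1 - p%:C ^+ 2 * z)).
    by rewrite c2; field; rewrite bN0 dN0.
  set r := _ / _.
  have -> : r - 1 = p%:C ^+ 2 * z * (r + 1) by rewrite /r; field.
  rewrite ComplexField.Normc.normcM normM.
  have := normc_ge0 (r + 1); have := normc_ge0 z => h1 h2.
  by rewrite ler_wpM2r // ler_piMr // ltW.
(* At [r = -1] the hypothesis would read [2 <= 0]. *)
have sN0 : r + 1 != 0.
  apply/eqP => /[dup] s0 /eqP; rewrite addr_eq0 => /eqP rm1.
  move: rle; rewrite s0 ComplexField.Normc.normc0 mulr0 rm1 => rle.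
  have/ComplexField.Normc.eq0_normc/eqP : normc (-1 - 1 : R[i]) = 0.
    by apply/le_anti; rewrite rle normc_ge0.
  by rewrite -opprD oppr_eq0 -(natrD _ 1 1) pnatr_eq0.
(* This solves [r = (1 + a zeta) / (1 - a zeta)] for [zeta]. *)
exists ((r - 1) / (p%:C ^+ 2 * (r + 1))) => /=.
  rewrite normE -(rmorph1 (real_complex R)) lecR ComplexField.Normc.normcM.
  rewrite ComplexField.Normc.normcV normM ler_pdivrMr ?mul1r //.
  rewrite mulr_gt0 // lt_def normc_ge0 andbT.
  by apply: contra sN0 => /eqP/ComplexField.Normc.eq0_normc ->.
have wE : w = (1 - r ^+ 2) / (2 * c)%:C.
  by rewrite rE c2; field; rewrite pN0 bN0.
have -> : 1 - p%:C ^+ 2 * ((r - 1) / (p%:C ^+ 2 * (r + 1))) = 2 / (r + 1).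
  by field; rewrite pN0 sN0.
by rewrite wE c2; field; rewrite pN0 bN0 sN0.
Qed.

Lemma Omega_criterion w :
  Omega p w <-> (2 + 2 * c) * normc w <= 1 + normc (1 - (2 * c)%:C * w).
Proof.
have /andP[a0 a1] := sqr_lt1 p0 p1.
have c0 : 0 < c := omega_param_gt0 p0 p1.
have cE : c * (1 - p ^+ 2) ^+ 2 = 2 * p ^+ 2 := omega_paramE p0 p1.
(* In terms of [A = |r + 1|] and [B = |r - 1|] both sides of the equivalence
   are governed by the sign of [(a A - B) (A - a B)]. *)
have key r : r ^+ 2 = 1 - (2 * c)%:C * w ->
    (2 + 2 * c) * normc w <= 1 + normc (1 - (2 * c)%:C * w) <->
    0 <= (p ^+ 2 * normc (r + 1) - normc (r - 1)) *
         (normc (r + 1) - p ^+ 2 * normc (r - 1)).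
  move=> rE; rewrite -rE normcX2.
  have := normc_parallelogram r.
  have : 2 * c * normc w = normc (r + 1) * normc (r - 1).
    rewrite -ComplexField.Normc.normcM -[2 * c in LHS]normc_real; last lra.
    rewrite -ComplexField.Normc.normcM -(normc_opp (_ * w)); congr normc.
    have -> : (r + 1) * (r - 1) = r ^+ 2 - 1 by ring.
    by rewrite rE; ring.
  move: (normc (r + 1)) (normc (r - 1)) (normc r) (normc w) => A B n m wE pE.
  have mE : 4 * p ^+ 2 * m = (1 - p ^+ 2) ^+ 2 * (A * B).
    rewrite -wE (_ : _ * (2 * c * m) = 2 * m * (c * (1 - p ^+ 2) ^+ 2)).
      by rewrite cE; ring.
    by ring.
  have nE : n ^+ 2 = (A ^+ 2 + B ^+ 2) / 2 - 1 by lra.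
  (* With [a = p ^+ 2], the product is [a (A^2 + B^2) - (1 + a^2) A B]. Splitting
     [1 + a^2 = (1 - a)^2 + 2 a] lets [mE] and [wE] rewrite the last term, and [nE] the first. *)
  have -> : (p ^+ 2 * A - B) * (A - p ^+ 2 * B) =
            2 * p ^+ 2 * (1 + n ^+ 2 - (2 + 2 * c) * m).
    rewrite [RHS]mulrBr (_ : 2 * p ^+ 2 * ((2 + 2 * c) * m) =
      4 * p ^+ 2 * m + 2 * p ^+ 2 * (2 * c * m)); last by ring.
    by rewrite mE wE nE; field.
  by rewrite pmulr_rge0 ?subr_ge0 //; lra.
split=> [/OmegaP[r rE rle]|cr].
  apply/(key r rE); have := normc_ge0 (r - 1); have := normc_ge0 (r + 1).
  by move=> ? ?; apply: mulr_ge0; nra.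
(* The product is also nonnegative when both factors are nonpositive. The root with [Re r >= 0]
   excludes this: it has [B <= A] and [A > 0], so [A - a B > 0]. *)
have [r rE r0] := complex_sqrt_Re_ge0 (1 - (2 * c)%:C * w).
apply/OmegaP; exists r => //; move/(key r rE): cr.
have := normc_ge0 (r - 1); have := normc_ge0 (r + 1).
have A0 : 0 < normc (r + 1) ^+ 2.
  by rewrite sqr_normcE; case: (r) r0 => x y /=; nra.
have : normc (r - 1) ^+ 2 <= normc (r + 1) ^+ 2.
  by rewrite !sqr_normcE; case: (r) r0 => x y /=; nra.
move: (normc (r + 1)) A0 (normc (r - 1)) => A A20 B AB A0 B0.
have {}A0 : 0 < A by nra.
have {}AB : B <= A by nra.
rewrite pmulr_lge0 ?subr_ge0 //; nra.
Qed.

End OmegaCriterion.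

(** * Monotonicity, union and intersection *)

Section Omegas.
Variable R : realType.
Implicit Types (p q : R) (w : R[i]).

Lemma Omega_subset p q : 0 < q -> q < p -> p < 1 -> Omega p `<=` Omega q.
Proof.
move=> q0 qp p1 w /(Omega_criterion (lt_trans q0 qp) p1) h.
apply/(Omega_criterion q0 (lt_trans qp p1)).
have le_c := omega_param_le q0 qp p1.
move: (omega_param p) (omega_param q) le_c h => c d dc h.
(* Passing from [c] down to [d] lowers the right side of the criterion by at most [2 (c - d) |w|],
   exactly the drop of the left side. *)
have : normc (1 - (2 * c)%:C * w) <=
       normc (1 - (2 * d)%:C * w) + 2 * (c - d) * normc w.
  have -> : 1 - (2 * c)%:C * w =
            (1 - (2 * d)%:C * w) + - ((2 * (c - d))%:C * w).
    by rewrite !(rmorphM, rmorphB, rmorph_nat); ring.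
  apply: le_trans (ler_normcD _ _) _; rewrite normc_opp.
  by rewrite ComplexField.Normc.normcM normc_real //; lra.
lra.
Qed.

(** The triangle inequality in the criterion gives [|w| <= 1]. If [|w| = 1], it must be an equality,
    which forces [Re w <= -1]. *)
Lemma Omega_sub_disk p : 0 < p -> p < 1 ->
  Omega p `<=` open_unit_disk R `|` [set - 1].
Proof.
move=> p0 p1 w /(Omega_criterion p0 p1).
have := omega_param_gt0 p0 p1; move: (omega_param p) => c c0 h.
have le1 : normc (1 - (2 * c)%:C * w) <= 1 + 2 * c * normc w.
  apply: le_trans (ler_normcD _ _) _; rewrite normc_opp.
  rewrite ComplexField.Normc.normcM normc_real; last lra.
  by rewrite ComplexField.Normc.normc1.
have [w1|w1] := ltP (normc w) 1.
  by left; rewrite /open_unit_disk /= normE -(rmorph1 (real_complex R)) ltcR.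
right => /=.
have {le1} wE : normc w = 1 by lra.
rewrite wE in h; have := sqr_normc_1subM (2 * c) w; rewrite wE => sE.
have := sqr_normcE w; rewrite wE.
have : complex.Re w <= -1.
  have : (1 + 2 * c) ^+ 2 <= normc (1 - (2 * c)%:C * w) ^+ 2.
    by rewrite ler_sqr ?nnegrE ?normc_ge0 //; lra.
  by rewrite sE; nra.
case: w {h w1 wE sE} => x y /= x1 xy.
have xE : x = -1 by nra.
have yE : y = 0 by apply/eqP; rewrite -sqrf_eq0; apply/eqP; nra.
by rewrite xE yE -(rmorphN1 (real_complex R)).
Qed.

(** The criterion is an equality at [w = -1], whatever [c] is. *)
Lemma Omega_N1 p : 0 < p -> p < 1 -> Omega p (-1).
Proof.
move=> p0 p1; apply/(Omega_criterion p0 p1).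
have := omega_param_gt0 p0 p1; move: (omega_param p) => c c0.
rewrite mulrN1 opprK -(rmorph1 (real_complex R)) -rmorphD normc_opp.
by rewrite !normc_real; lra.
Qed.

Lemma disk_sub_Omega w : open_unit_disk R w ->
  exists p, [/\ 0 < p, p < 1 & Omega p w].
Proof.
rewrite /open_unit_disk /= normE -(rmorph1 (real_complex R)) ltcR => w1.
have w0 := normc_ge0 w.
(* By the triangle inequality [(1 + 2 c) |w| <= 1] suffices. This [p] gives [2 c <= 1 - |w|], and
   [(2 - |w|) |w| <= 1]. *)
pose p := (1 - normc w) / 4.
have p0 : 0 < p by rewrite /p; lra.
have p4 : p <= 4^-1 by rewrite /p; lra.
have p1 : p < 1 by lra.
exists p; split=> //; apply/(Omega_criterion p0 p1).
have := omega_param_gt0 p0 p1.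
have : omega_param p <= 2 * p by apply: omega_param_small => //; lra.
move: (omega_param p) => c cp c0.
have : 1 <= normc (1 - (2 * c)%:C * w) + 2 * c * normc w.
  rewrite -[X in X <= _](@ComplexField.Normc.normc1 R).
  rewrite -{1}(subrK ((2 * c)%:C * w) 1).
  apply: le_trans (ler_normcD _ _) _.
  by rewrite ComplexField.Normc.normcM [normc (2 * c)%:C]normc_real //; lra.
have : c <= (1 - normc w) / 2 by rewrite /p in cp; lra.
nra.
Qed.

(** With [n = |w|] and [D = 2 n^2 - (n - Re w)], squaring [(2 + 2 c) n - 1 <= |1 - 2 c w|] leaves
    [n (n - 1) + c D <= 0]. For large [c] the sign of [D] decides; conversely [D <= 0] implies
    [n <= 1]. *)
Lemma bigcap_OmegaP w :
  (forall p, 0 < p < 1 -> Omega p w) <->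
  2 * normc w ^+ 2 <= normc w - complex.Re w.
Proof.
have w0 := normc_ge0 w.
split=> [h|h p /andP[p0 p1]].
  have [//|lt] := leP.
  pose n := normc w; pose D := 2 * n ^+ 2 - (n - complex.Re w).
  have D0 : 0 < D by rewrite subr_gt0.
  have n0 : 0 < n.
    rewrite lt_def w0 andbT; apply/eqP => n0.
    have w00 := ComplexField.Normc.eq0_normc n0.
    by move: lt; rewrite w00 ComplexField.Normc.normc0 /=; lra.
  (* The term [n^-1] makes the squared side nonnegative; [(n + 1) / D] gives [c D >= n + 1], hence
     [n (n - 1) + c D > 0]. *)
  have [p [p0 p1 Mc]] := omega_param_unbounded (n^-1 + (n + 1) / D).
  have /(Omega_criterion p0 p1) : Omega p w by apply: h; rewrite p0 p1.
  have := sqr_normc_1subM (2 * omega_param p) w; rewrite -/n.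
  have := omega_param_gt0 p0 p1.
  move: (omega_param p) Mc => c Mc c0.
  have cn : 1 <= c * n.
    rewrite -ler_pdivrMr // div1r; apply: le_trans Mc.
    by rewrite lerDl divr_ge0 //; lra.
  have cD : n + 1 <= c * D.
    rewrite -ler_pdivrMr //; apply: le_trans Mc.
    by rewrite lerDr invr_ge0; lra.
  move: (normc (1 - _)) => S SE cr.
  have : ((2 + 2 * c) * n - 1) ^+ 2 <= S ^+ 2 by nra.
  by rewrite SE => {}cr; rewrite /D in cD; nra.
apply/(Omega_criterion p0 p1); have := omega_param_gt0 p0 p1.
move: (omega_param p) => c c0.
have := sqr_normc_1subM (2 * c) w; have := normc_ge0 (1 - (2 * c)%:C * w).
have := sqr_normcE w; move: h (normc (1 - _)).
move: (normc w) w0 (complex.Re w) (complex.Im w) => n n0 x y h S nE S0 SE.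
have xn : - n <= x by nra.
have n1 : n <= 1 by nra.
have : ((2 + 2 * c) * n - 1) ^+ 2 <= S ^+ 2.
  have cD : 0 <= c * (n - x - 2 * n ^+ 2) by rewrite mulr_ge0 //; lra.
  by rewrite SE; nra.
nra.
Qed.

(** Put [t = (1 + z) / 2], so [w = - t^2]. Then [|z| <= 1] means [|t|^2 <= Re t], while the right
    side means [|t|^4 <= (Re t)^2]; the two agree once [Re t >= 0]. *)
Lemma neg_quarter_squareP w :
  (exists2 z : R[i], `|z| <= 1 & - ((1 + z) ^+ 2 / 4) = w) <->
  2 * normc w ^+ 2 <= normc w - complex.Re w.
Proof.
have [s sE s0] := complex_sqrt_Re_ge0 (- w).
have normle1 (z : R[i]) : (`|z| <= 1) = (normc z ^+ 2 <= 1).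
  rewrite normE -(rmorph1 (real_complex R)) lecR -{2}(expr1n R 2).
  by rewrite ler_sqr ?nnegrE ?normc_ge0.
have half t : - t ^+ 2 = w -> normc w = normc t ^+ 2 /\
    normc w - complex.Re w = 2 * complex.Re t ^+ 2.
  move=> <-; rewrite normc_opp normcX2; split=> //.
  by rewrite sqr_normcE; case: t => x y /=; ring.
split=> [[z z1 zE]|h].
  have [] := half ((1 + z) / 2).
    by rewrite -zE; field.
  move=> -> ->.
  have -> : (1 + z) / 2 = (2^-1)%:C * (1 + z).
    by rewrite fmorphV rmorph_nat mulrC.
  rewrite normle1 sqr_normcE in z1.
  rewrite sqr_normcE; case: z z1 {zE} => x y /=; rewrite !mul0r subr0 add0r addr0.
  move=> xy.
  have : 0 <= ((1 + x) / 2) ^+ 2 + (y / 2) ^+ 2 <= (1 + x) / 2 by nra.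
  nra.
have wE : - s ^+ 2 = w by rewrite sE opprK.
have [nE rE] := half s wE.
exists (2 * s - 1); last by rewrite -wE; field.
rewrite normle1; move: h; rewrite rE nE.
rewrite !sqr_normcE -(rmorph_nat (real_complex R)).
by case: (s) s0 => x y /= x0 h; nra.
Qed.

End Omegas.

Theorem proposition1p1 (R : realType) :
  [/\ forall p q : R, 0 < q -> q < p -> p < 1 -> Omega p `<=` Omega q,
      \bigcup_(p in [set p : R | 0 < p < 1]) Omega p =
        open_unit_disk R `|` [set - 1]
    & \bigcap_(p in [set p : R | 0 < p < 1]) Omega p =
        [set - ((1 + z) ^+ 2 / 4) | z in [set z : R[i] | `|z| <= 1]]].
Proof.
split; first exact: Omega_subset.
- apply/seteqP; split=> [w [p /= /andP[p0 p1]]|w [/disk_sub_Omega[p [p0 p1 ?]]|->]].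
  + exact: Omega_sub_disk.
  + by exists p => //=; rewrite p0 p1.
  + exists 2^-1 => /=; first lra.
    by apply: Omega_N1; lra.
- apply/seteqP; split=> w h.
  + by apply/neg_quarter_squareP/bigcap_OmegaP.
  + by apply/bigcap_OmegaP/neg_quarter_squareP.
Qed.
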